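(* For $A\in\mathcal{PM}(n)$, $B\in\mathcal{PM}(m)$ and $i\in[n]$ define $$A\,\square_i\,B=\begin{pmatrix}A_{11}&\mathbb{O}&\mathbb{O}\\ \mathbb{1}_m^T\otimes A_{(i)}&B&\mathbb{O}\\ A_{21}&\mathbb{1}_m\otimes A^{(i)}&A_{22}\end{pmatrix}.$$ Then the maps $\square_i$ endow $\mathcal{PM}=\bigsqcup_{n\ge1}\mathcal{PM}(n)$ with a set operad structure, that is: (a) $A\,\square_i\,B\in\mathcal{PM}(n+m-1)$ for all $A\in\mathcal{PM}(n)$, $B\in\mathcal{PM}(m)$, $i\in[n]$; (b) for all $A\in\mathcal{PM}(n)$, $B\in\mathcal{PM}(m)$, $C\in\mathcal{PM}(k)$, $i\in[n]$, $j\in[m]$: $(A\,\square_i\,B)\,\square_{i+j-1}\,C=A\,\square_i\,(B\,\square_j\,C)$; (c) for all $A\in\mathcal{PM}(n)$, $B\in\mathcal{PM}(m)$, $C\in\mathcal{PM}(k)$ and $1\le i<j\le n$: $(A\,\square_i\,B)\,\square_{j+m-1}\,C=(A\,\square_j\,C)\,\square_i\,B$; (d) the $1\times1$ matrix $[1]$ is a unit: $[1]\,\square_1\,A=A\,\square_i\,[1]=A$ for all $A\in\mathcal{PM}(n)$, $i\in[n]$.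
   Context: A poset matrix of order $n$ is an $n\times n$ $(0,1)$-matrix $A=[a_{st}]$ that is lower triangular with all diagonal entries $1$ and transitive ($a_{st}=a_{tu}=1\Rightarrow a_{su}=1$); $\mathcal{PM}(n)$ is the set of these. $A[\alpha\mid\beta]$ is the submatrix with rows $\alpha$ and columns $\beta$, $A[\alpha]=A[\alpha\mid\alpha]$. For $A\in\mathcal{PM}(n)$ and $i\in[n]$: $A_{11}=A[\{1,\dots,i-1\}]$, $A_{22}=A[\{i+1,\dots,n\}]$, $A_{21}=A[\{i+1,\dots,n\}\mid\{1,\dots,i-1\}]$, $A_{(i)}=A[\{i\}\mid\{1,\dots,i-1\}]$ (a row vector of length $i-1$) and $A^{(i)}=A[\{i+1,\dots,n\}\mid\{i\}]$ (a column vector of length $n-i$); empty blocks are vacuous. $\mathbb{1}_m^T\otimes A_{(i)}$ is the $m\times(i-1)$ matrix all of whose rows equal $A_{(i)}$, and $\mathbb{1}_m\otimes A^{(i)}$ is the $(n-i)\times m$ matrix all of whose columns equal $A^{(i)}$. *)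

(* Defs.v *)
From mathcomp Require Import all_boot all_order all_algebra.
Set Implicit Arguments.
Unset Strict Implicit.
Unset Printing Implicit Defensive.
Import GRing.Theory.
Local Open Scope ring_scope.

(* Indices are 0-based: the mathematical index i in [n] is the ordinal of
   value i - 1. *)

(* [is_trig_mx] is lower triangularity: A s t = 0 whenever s < t. *)
Definition PM (n : nat) : {pred 'M[int]_n} :=
  [pred A : 'M[int]_n |
    [&& [forall s, forall t, (A s t == 0) || (A s t == 1)],
        is_trig_mx A,
        [forall s, A s s == 1] &
        [forall s, forall t, forall u,
           (A s t == 1) && (A t u == 1) ==> (A s u == 1)]]].
Arguments PM n : clear implicits.

Definition before (n : nat) (i : 'I_n) (s : 'I_i) : 'I_n :=
  widen_ord (ltnW (ltn_ord i)) s.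

Lemma after_subproof (n : nat) (i : 'I_n) (s : 'I_(n - i.+1)) :
  (i.+1 + s < n)%N.
Proof. by rewrite -ltn_subRL. Qed.

Definition after (n : nat) (i : 'I_n) (s : 'I_(n - i.+1)) : 'I_n :=
  Ordinal (after_subproof s).

Section Blocks.
Variables (n : nat) (A : 'M[int]_n) (i : 'I_n).

Definition blk11 : 'M[int]_i := mxsub (@before n i) (@before n i) A.
Definition blk22 : 'M[int]_(n - i.+1) := mxsub (@after n i) (@after n i) A.
Definition blk21 : 'M[int]_(n - i.+1, i) := mxsub (@after n i) (@before n i) A.
Definition blk_row : 'rV[int]_i := mxsub (fun=> i) (@before n i) A.
Definition blk_col : 'cV[int]_(n - i.+1) := mxsub (@after n i) (fun=> i) A.
End Blocks.

Definition rep_row (m p : nat) (v : 'rV[int]_p) : 'M[int]_(m, p) :=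
  \matrix_(s, t) v 0 t.
Definition rep_col (m p : nat) (v : 'cV[int]_p) : 'M[int]_(p, m) :=
  \matrix_(s, t) v s 0.

Lemma square_order (n m : nat) (i : 'I_n) :
  (i + m + (n - i.+1) = n + m - 1)%N.
Proof.
by rewrite addnAC -[in RHS](subnKC (ltn_ord i)) addSn addSn subn1.
Qed.

(* The 3 x 3 block matrix, with its first two block rows and columns grouped. *)
Definition square (n m : nat) (i : 'I_n) (A : 'M[int]_n) (B : 'M[int]_m) :
    'M[int]_(n + m - 1) :=
  castmx (square_order m i, square_order m i)
    (block_mx
       (block_mx (blk11 A i)               0
                 (rep_row m (blk_row A i)) B)                         0
       (row_mx   (blk21 A i)               (rep_col m (blk_col A i))) (blk22 A i)).

(* The index i + j - 1 of B's j-th element inside A square_i B. *)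
Lemma nested_idx_subproof (n m : nat) (i : 'I_n) (j : 'I_m) :
  (i + j < n + m - 1)%N.
Proof.
case: n i => [[]//|n] i; case: m j => [[]//|m] j.
by rewrite addnS subn1 /= addSn ltnS leq_add // -ltnS.
Qed.

Definition nested_idx (n m : nat) (i : 'I_n) (j : 'I_m) : 'I_(n + m - 1) :=
  Ordinal (nested_idx_subproof i j).

(* For i < j, the index j + m - 1 of A's j-th element inside A square_i B;
   in 0-based form too, the value is j + m - 1. *)
Lemma right_idx_subproof (n m : nat) (i j : 'I_n) (lt_ij : (i < j)%N) :
  (j + m - 1 < n + m - 1)%N.
Proof.
apply: ltn_sub2r; last by rewrite ltn_add2r.
by apply: leq_trans (leq_addr m n); apply: leq_ltn_trans (ltn_ord j); apply: leq_ltn_trans lt_ij.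
Qed.

Definition right_idx (n m : nat) (i j : 'I_n) (lt_ij : (i < j)%N) :
  'I_(n + m - 1) := Ordinal (right_idx_subproof m lt_ij).

(* For i < j, the index i of A's i-th element inside A square_j C. *)
Lemma left_idx_subproof (n k : nat) (i j : 'I_n) (lt_ij : (i < j)%N) :
  (i < n + k - 1)%N.
Proof.
rewrite ltn_subRL add1n; apply: leq_trans (leq_addr k n).
exact: leq_ltn_trans lt_ij (ltn_ord j).
Qed.

Definition left_idx (n k : nat) (i j : 'I_n) (lt_ij : (i < j)%N) :
  'I_(n + k - 1) := Ordinal (left_idx_subproof k lt_ij).

(* The embedding of order-n matrices in the disjoint union over all orders.
   Both sides of the operad identities have orders that are equal but not
   convertible; they are compared in this disjoint union. *)
Definition in_union (n : nat) (A : 'M[int]_n) : {n : nat & 'M[int]_n} :=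
  Tagged (fun n => 'M[int]_n) A.

(* Main.v *)
(* Extend matrices by zero to functions on pairs of naturals. Let
   c = collapse i m : nat -> nat contract the interval [i, i + m[ to the point i.
   Then for lower triangular A the entry of A square_i B at (a, b) is that of B
   at (a - i, b - i) when a and b both lie in the interval, and that of A at
   (c a, c b) otherwise: the zero blocks need no separate case, as A vanishes
   above its diagonal. The operad identities become identities between
   collapsing maps. *)
Require Import Defs.
From mathcomp Require Import all_boot all_order all_algebra.
From mathcomp Require Import zify.
Set Implicit Arguments.
Unset Strict Implicit.
Unset Printing Implicit Defensive.
Import GRing.Theory.
Local Open Scope ring_scope.

(** * Entries of matrices as functions on pairs of naturals *)

Definition entry (p q : nat) (A : 'M[int]_(p, q)) (a b : nat) : int :=
  if (insub a, insub b) is (Some s, Some t) then A s t else 0.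

Lemma entryE (p q : nat) (A : 'M[int]_(p, q)) (s : 'I_p) (t : 'I_q) :
  entry A s t = A s t.
Proof. by rewrite /entry !valK. Qed.

Lemma entry_out (p q : nat) (A : 'M[int]_(p, q)) (a b : nat) :
  (p <= a)%N || (q <= b)%N -> entry A a b = 0.
Proof.
rewrite /entry; case: insubP => // s + _; case: insubP => // t; lia.
Qed.

Lemma entry_castmx (p q p' q' : nat) (e : (p = p') * (q = q'))
    (A : 'M[int]_(p, q)) (a b : nat) :
  entry (castmx e A) a b = entry A a b.
Proof. by case: e => ep eq; case: p' / ep; case: q' / eq. Qed.

(** [f'] and [g'] are the index maps read on naturals, so that locating an entry of a submatrix
    becomes arithmetic in [a] and [b]. *)
Lemma entry_mxsub (p q p' q' : nat) (A : 'M[int]_(p, q)) (f : 'I_p' -> 'I_p)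
    (g : 'I_q' -> 'I_q) (f' g' : nat -> nat) (a b : nat) :
    (forall s, f s = f' s :> nat) -> (forall t, g t = g' t :> nat) ->
    (a < p')%N -> (b < q')%N ->
  entry (mxsub f g A) a b = entry A (f' a) (g' b).
Proof.
move=> ff gg lt_a lt_b.
by rewrite -[a]/(val (Ordinal lt_a)) -[b]/(val (Ordinal lt_b)) -ff -gg !entryE mxE.
Qed.

Lemma entry_row_mx (p q1 q2 : nat) (A : 'M[int]_(p, q1)) (B : 'M[int]_(p, q2))
    (a b : nat) :
  entry (row_mx A B) a b =
  if (b < q1)%N then entry A a b else entry B a (b - q1).
Proof.
have [lt_a|ge_a] := ltnP a p; last by rewrite !entry_out ?ge_a // if_same.
have [lt_b|ge_b] := ltnP b (q1 + q2); last first.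
  by rewrite !entry_out; [case: ifP; lia | lia | lia | lia].
rewrite -[a]/(val (Ordinal lt_a)) -[b]/(val (Ordinal lt_b)) entryE mxE.
case: splitP => t /= ->; rewrite -[a]/(val (Ordinal lt_a));
  by rewrite ?addKn entryE.
Qed.

Lemma entry_col_mx (p1 p2 q : nat) (A : 'M[int]_(p1, q)) (B : 'M[int]_(p2, q))
    (a b : nat) :
  entry (col_mx A B) a b =
  if (a < p1)%N then entry A a b else entry B (a - p1) b.
Proof.
have [lt_b|ge_b] := ltnP b q; last by rewrite !entry_out ?ge_b ?orbT // if_same.
have [lt_a|ge_a] := ltnP a (p1 + p2); last first.
  by rewrite !entry_out; [case: ifP; lia | lia | lia | lia].
rewrite -[a]/(val (Ordinal lt_a)) -[b]/(val (Ordinal lt_b)) entryE mxE.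
case: splitP => t /= ->; rewrite -[b]/(val (Ordinal lt_b));
  by rewrite ?addKn entryE.
Qed.

Lemma entry0 (p q a b : nat) : entry (0 : 'M[int]_(p, q)) a b = 0.
Proof. by rewrite /entry; do 2![case: insub => // ?]; rewrite mxE. Qed.

(** Once [q] is replaced by [p], both matrices have one type and the entries at ordinals decide.
    Orders that are equal but not convertible thus cost only arithmetic. *)
Lemma in_union_entry (p q : nat) (A : 'M[int]_p) (B : 'M[int]_q) :
  p = q -> (forall a b, entry A a b = entry B a b) -> in_union A = in_union B.
Proof.
move=> eq_pq; case: q / eq_pq B => B eqAB; congr in_union.
by apply/matrixP => s t; rewrite -!entryE.
Qed.

(** * Poset conditions and the composition, read on entries *)

Definition poset_entries (n : nat) (e : nat -> nat -> int) : Prop :=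
  [/\ forall a b, e a b = 0 \/ e a b = 1,
      forall a b, (a < b)%N -> e a b = 0,
      forall a, (a < n)%N -> e a a = 1 &
      forall a b c, e a b = 1 -> e b c = 1 -> e a c = 1].

(** Only reflexivity carries a bound: zeros out of range respect the 0/1 and triangularity
    conditions, and an entry equal to 1 forces its indices into range. *)
Lemma PM_entries (n : nat) (A : 'M[int]_n) :
  A \in PM n <-> poset_entries n (entry A).
Proof.
split.
  rewrite inE => /and4P[/forallP A01 /is_trig_mxP Atrig /forallP A1 /forallP Atr].
  split=> [a b|a b lt_ab|a lt_an|a b c].
  - rewrite /entry; case: insubP => [s _ _|_]; last by left.
    case: insubP => [t _ _|_]; last by left.
    by case/orP: (forallP (A01 s) t) => /eqP; [left | right].
  - rewrite /entry; case: insubP => // s _ def_a; case: insubP => // t _ def_b.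
    by apply: Atrig; rewrite def_a def_b.
  - by rewrite -[a]/(val (Ordinal lt_an)) entryE; apply/eqP.
  - rewrite /entry; case: insubP => // s _ _; case: insubP => // t _ _.
    case: insubP => // u _ _ /eqP Ast /eqP Atu; apply/eqP.
    by move: (forallP (forallP (Atr s) t) u); rewrite Ast Atu.
case=> A01 Atrig A1 Atr; rewrite inE; apply/and4P; split.
- apply/forallP=> s; apply/forallP=> t; rewrite -entryE.
  by case: (A01 s t) => ->.
- by apply/is_trig_mxP=> s t lt_st; rewrite -entryE Atrig.
- by apply/forallP=> s; rewrite -entryE A1.
- apply/forallP=> s; apply/forallP=> t; apply/forallP=> u; rewrite -!entryE.
  by apply/implyP=> /andP[/eqP st /eqP tu]; apply/eqP; apply: Atr tu.
Qed.

(** Past the interval an index drops by m - 1. Written [a + 1 - m], this stays right for m = 0,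
    where the map skips i. *)
Definition collapse (i m a : nat) : nat :=
  if (a < i)%N then a else if (a < i + m)%N then i else (a + 1 - m)%N.

Definition in_block (i m a : nat) : bool := (i <= a < i + m)%N.

Lemma entry_square (n m : nat) (i : 'I_n) (A : 'M[int]_n) (B : 'M[int]_m)
    (a b : nat) :
  A \in PM n ->
  entry (square i A B) a b =
  if in_block i m a && in_block i m b then entry B (a - i) (b - i)
  else entry A (collapse i m a) (collapse i m b).
Proof.
move=> /PM_entries[_ Atrig _ _]; have lt_in := ltn_ord i.
(* Out of range both sides vanish: as i < n, an index at least n + m - 1 lies past the interval and
   collapses to at least n. *)
have [lt_ab|] := boolP ((a < n + m - 1) && (b < n + m - 1))%N; last first.
  rewrite negb_and -!leqNgt => ge_ab; rewrite entry_out // /in_block.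
  case: ifP => [?|_]; first by lia.
  by rewrite entry_out // /collapse; move: ge_ab; do 4?case: ifP; lia.
rewrite /square entry_castmx /block_mx.
rewrite !(entry_col_mx, entry_row_mx) !entry0 /in_block /collapse.
(* The repeated row and column are submatrices with a constant index map, so [entry_mxsub] handles
   every block taken from A. *)
have rowE : rep_row m (blk_row A i) = mxsub (fun=> i) (@before n i) A.
  by apply/matrixP=> s t; rewrite !mxE.
have colE : rep_col m (blk_col A i) = mxsub (@after n i) (fun=> i) A.
  by apply/matrixP=> s t; rewrite !mxE.
rewrite rowE colE /blk11 /blk21 /blk22.
have sub p q f g := @entry_mxsub n n p q A f g.
(* In the zero blocks the collapsed row index is below the collapsed column index, whence [Atrig].
   Past the interval, [addn i.+1] matches the collapse: i + 1 + (a - (i + m)) = a + 1 - m. *)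
case: (ltnP a (i + m)) => a2; case: (ltnP b (i + m)) => b2;
  case: (ltnP a i) => a1; case: (ltnP b i) => b1;
  rewrite ?andbF //=; try lia.
- by rewrite (sub _ _ _ _ id id).
- by rewrite Atrig.
- by rewrite (sub _ _ _ _ (fun=> val i) id) //; lia.
- by rewrite Atrig //; lia.
- by rewrite Atrig //; lia.
- by rewrite (sub _ _ _ _ (addn i.+1) id) //; [congr entry; lia | lia].
- by rewrite (sub _ _ _ _ (addn i.+1) (fun=> val i)) //; [congr entry; lia | lia | lia].
- by rewrite (sub _ _ _ _ (addn i.+1) (addn i.+1)) //; [congr entry; lia | lia | lia].
Qed.

(** * Closure of poset matrices under composition *)

Lemma collapse_lt (i m a b : nat) :
  (a < b)%N -> ~~ (in_block i m a && in_block i m b) ->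
  (collapse i m a < collapse i m b)%N.
Proof. rewrite /in_block /collapse; do 4?case: ifP; lia. Qed.

Lemma collapse_block (i m a : nat) : in_block i m a -> collapse i m a = i.
Proof. rewrite /in_block /collapse; do 2?case: ifP; lia. Qed.

Lemma collapse_eq (i m a : nat) :
  (0 < m)%N -> collapse i m a = i -> in_block i m a.
Proof. rewrite /in_block /collapse; do 2?case: ifP; lia. Qed.

Lemma square_PM (n m : nat) (i : 'I_n) (A : 'M[int]_n) (B : 'M[int]_m) :
  (0 < m)%N -> A \in PM n -> B \in PM m -> square i A B \in PM (n + m - 1).
Proof.
move=> m_gt0 PA PB; apply/PM_entries.
have [A01 Atrig A1 Atr] := (PM_entries A).1 PA.
have [B01 Btrig B1 Btr] := (PM_entries B).1 PB.
split=> [a b|a b lt_ab|a lt_a|a b c]; rewrite !entry_square //.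
- by case: ifP.
- case: ifPn => [|nblk]; last by apply/Atrig/collapse_lt.
  by rewrite /in_block => ?; apply: Btrig; lia.
- have := ltn_ord i; rewrite andbb; case: ifP => blk lt_in.
    by apply: B1; move: blk; rewrite /in_block; lia.
  by apply: A1; move: blk; rewrite /in_block /collapse; do 2?case: ifP; lia.
(* Antisymmetry: for distinct x and y one of the two entries lies above the diagonal. *)
have A_anti x y : entry A x y = 1 -> entry A y x = 1 -> x = y.
  by case: (ltngtP x y) => // /Atrig ->.
have blkE x : in_block i m x -> collapse i m x = i by exact: collapse_block.
have blkN x : collapse i m x = i -> in_block i m x by exact: collapse_eq.
(* Three indices in the block use transitivity of B, at most one that of A. If exactly two are in
   the block, both collapse to i: for a, b or b, c one premise is already the goal; for a, c
   antisymmetry would put b in the block. *)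
case: (boolP (in_block i m a)) => blk_a; case: (boolP (in_block i m b)) => blk_b;
  case: (boolP (in_block i m c)) => blk_c //=; try exact: Atr; try exact: Btr.
- by move=> _; rewrite (blkE _ blk_a) (blkE _ blk_b).
- rewrite (blkE _ blk_a) (blkE _ blk_c) => Aib Abi.
  by case/negP: blk_b; apply: blkN; exact: A_anti Abi Aib.
- by rewrite (blkE _ blk_b) (blkE _ blk_c).
Qed.

(** * Nested and parallel composition *)

Lemma square_nested (n m k : nat) (i : 'I_n) (j : 'I_m)
    (A : 'M[int]_n) (B : 'M[int]_m) (C : 'M[int]_k) :
  (0 < k)%N -> A \in PM n -> B \in PM m -> C \in PM k ->
  in_union (square (nested_idx i j) (square i A B) C) =
  in_union (square i A (square j B C)).
Proof.
move=> k_gt0 PA PB PC; have lt_in := ltn_ord i; have lt_jm := ltn_ord j.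
apply: in_union_entry => [|a b]; first by lia.
rewrite !entry_square ?square_PM //=; last by lia.
(* The interval of C lies inside the one of length m + k - 1 that replaces the point i of A.
   Collapsing the inner interval and then what remains collapses the whole. *)
have cc x : collapse i m (collapse (i + j) k x) = collapse i (m + k - 1) x.
  by rewrite /collapse; do 6?case: ifP; lia.
have bc x : in_block i m (collapse (i + j) k x) = in_block i (m + k - 1) x.
  by rewrite /in_block /collapse; do 2?case: ifP; lia.
have bs x : in_block i (m + k - 1) x -> in_block j k (x - i) = in_block (i + j) k x.
  by rewrite /in_block; lia.
(* Inside the large interval, shifting by i turns the collapse at i + j into the collapse at j. *)
have cs x : in_block i (m + k - 1) x ->
    (collapse (i + j) k x - i = collapse j k (x - i))%N.
  by rewrite /in_block /collapse; do 4?case: ifP; lia.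
have sub x : in_block (i + j) k x -> in_block i (m + k - 1) x.
  by rewrite /in_block; lia.
rewrite !cc !bc.
have [/andP[blk_a blk_b]|blk] :=
  boolP (in_block i (m + k - 1) a && in_block i (m + k - 1) b).
  by rewrite !bs // !cs // !subnDA.
by case: ifP => // /andP[/sub blk_a /sub blk_b]; rewrite blk_a blk_b in blk.
Qed.

(** Collapses of disjoint intervals commute. The interval of C starts at j + m - 1, and at j once
    that of B is collapsed; that of B starts at i throughout, since i < j. *)
Lemma square_parallel (n m k : nat) (i j : 'I_n) (lt_ij : (i < j)%N)
    (A : 'M[int]_n) (B : 'M[int]_m) (C : 'M[int]_k) :
  (0 < m)%N -> (0 < k)%N -> A \in PM n -> B \in PM m -> C \in PM k ->
  in_union (square (right_idx m lt_ij) (square i A B) C) =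
  in_union (square (left_idx k lt_ij) (square j A C) B).
Proof.
move=> m_gt0 k_gt0 PA PB PC; have lt_jn := ltn_ord j.
apply: in_union_entry => [|a b]; first by lia.
rewrite !entry_square ?square_PM //=.
have cc x : collapse i m (collapse (j + m - 1) k x) =
            collapse j k (collapse i m x).
  by rewrite /collapse; do 8?case: ifP; lia.
have bi x : in_block i m (collapse (j + m - 1) k x) = in_block i m x.
  by rewrite /in_block /collapse; do 2?case: ifP; lia.
have bj x : in_block j k (collapse i m x) = in_block (j + m - 1) k x.
  by rewrite /in_block /collapse; do 2?case: ifP; lia.
have disj x : in_block i m x -> in_block (j + m - 1) k x = false.
  by rewrite /in_block; lia.
have si x : in_block i m x -> collapse (j + m - 1) k x = x.
  by rewrite /in_block /collapse; do 2?case: ifP; lia.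
have sj x : in_block (j + m - 1) k x ->
    (collapse i m x - j = x - (j + m - 1))%N.
  by rewrite /in_block /collapse; do 2?case: ifP; lia.
rewrite !cc !bi !bj.
(* The two sides test the blocks of B and C in opposite orders; disjointness reconciles them. *)
have [/andP[blk_a blk_b]|_] := boolP (in_block i m a && in_block i m b).
  by rewrite (disj a) // !si.
by case: ifP => // /andP[blk_a blk_b]; rewrite !sj.
Qed.

(** * The unit *)

Lemma one_PM : (const_mx 1 : 'M[int]_1) \in PM 1.
Proof.
rewrite inE; apply/and4P; split.
- by apply/forallP=> s; apply/forallP=> t; rewrite mxE eqxx orbT.
- by apply/is_trig_mxP=> s t; rewrite !ord1.
- by apply/forallP=> s; rewrite mxE.
- by apply/forallP=> s; apply/forallP=> t; apply/forallP=> u; rewrite !mxE.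
Qed.

(** The block of A fills the whole range; an index outside it collapses to at least 1, beyond the
    order of the matrix [1]. *)
Lemma square1l (n : nat) (A : 'M[int]_n) :
  in_union (square (ord0 : 'I_1) (const_mx 1 : 'M[int]_1) A) = in_union A.
Proof.
apply: in_union_entry => [|a b]; first by lia.
rewrite entry_square ?one_PM //= !subn0.
case: ifPn => // blk; rewrite !entry_out //.
  by move: blk; rewrite /in_block; lia.
by move: blk; rewrite /in_block /collapse; do 4?case: ifP; lia.
Qed.

(** Collapsing an interval of length 1 changes nothing, so only the entry at (i, i) is read from the
    unit, and there A also has a 1. *)
Lemma square1r (n : nat) (i : 'I_n) (A : 'M[int]_n) :
  A \in PM n -> in_union (square i A (const_mx 1 : 'M[int]_1)) = in_union A.
Proof.
move=> PA; have [_ _ A1 _] := (PM_entries A).1 PA.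
have [_ _ U1 _] := (PM_entries _).1 one_PM.
apply: in_union_entry => [|a b]; first by lia.
have c1 x : collapse i 1 x = x by rewrite /collapse; do 2?case: ifP; lia.
rewrite entry_square // !c1; case: ifP => // /andP[blk_a blk_b].
have [-> ->] : a = i /\ b = i by move: blk_a blk_b; rewrite /in_block; lia.
by rewrite subnn U1 // A1.
Qed.

Theorem theorem2 :
  [/\ (* (a) *)
      forall (n m : nat) (i : 'I_n) (A : 'M[int]_n) (B : 'M[int]_m),
        (0 < m)%N -> A \in PM n -> B \in PM m ->
        square i A B \in PM (n + m - 1),
      (* (b) *)
      forall (n m k : nat) (i : 'I_n) (j : 'I_m)
             (A : 'M[int]_n) (B : 'M[int]_m) (C : 'M[int]_k),
        (0 < k)%N -> A \in PM n -> B \in PM m -> C \in PM k ->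
        in_union (square (nested_idx i j) (square i A B) C) =
        in_union (square i A (square j B C)),
      (* (c) *)
      forall (n m k : nat) (i j : 'I_n) (lt_ij : (i < j)%N)
             (A : 'M[int]_n) (B : 'M[int]_m) (C : 'M[int]_k),
        (0 < m)%N -> (0 < k)%N -> A \in PM n -> B \in PM m -> C \in PM k ->
        in_union (square (right_idx m lt_ij) (square i A B) C) =
        in_union (square (left_idx k lt_ij) (square j A C) B)
    & (* (d) *)
      (const_mx 1 : 'M[int]_1) \in PM 1 /\
      forall (n : nat) (i : 'I_n) (A : 'M[int]_n),
        A \in PM n ->
        in_union (square (ord0 : 'I_1) (const_mx 1 : 'M[int]_1) A) = in_union A /\
        in_union (square i A (const_mx 1 : 'M[int]_1)) = in_union A].
Proof.
split; first exact: square_PM.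
- exact: square_nested.
- exact: square_parallel.
split=> [|n i A PA]; first exact: one_PM.
by split; [exact: square1l | exact: square1r].
Qed.
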